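(* Let $a,b\in\mathbb{R}$, let $f:\mathbb{N}_a\cap{_{b}\mathbb{N}}\to\mathbb{R}$ and let $f^*:\mathbb{N}_{-b}\cap{_{-a}\mathbb{N}}\to\mathbb{R}$, $f^*(t)=f(-t)$, be its symmetric dual. Let $n\geq 1$ be an integer and $n-1<\alpha\leq n$. Then for every $t\in\mathbb{N}_{a+n}\cap{_{b}\mathbb{N}}$, $$(\nabla_a^{\alpha}f)(t)=({_{-a}\nabla^{\alpha}}f^* )(-t),$$ i.e. the nabla left Riemann--Liouville fractional difference of $f$ starting at $a$, evaluated at $t$, equals the nabla right Riemann--Liouville fractional difference of $f^*$ ending at $-a$, evaluated at $-t$.
   Context: For real $a,b$: $\mathbb{N}_a=\{a,a+1,\ldots\}$, ${_{b}\mathbb{N}}=\{b,b-1,\ldots\}$. $\rho(t)=t-1$. Difference operators: $\Delta f(t)=f(t+1)-f(t)$, $\nabla f(t)=f(t)-f(t-1)$, with $\Delta^n,\nabla^n$ their iterates, and ${_{\circleddash}\Delta^n}=(-1)^n\Delta^n$. Rising function: $t^{\overline{\alpha}}=\Gamma(t+\alpha)/\Gamma(t)$ for $t\notin\{\ldots,-2,-1,0\}$, $0^{\overline{\alpha}}=0$. For $\beta>0$, nabla left and right fractional sums: $$\nabla_a^{-\beta}f(t)=\frac{1}{\Gamma(\beta)}\sum_{s=a+1}^{t}(t-\rho(s))^{\overline{\beta-1}}f(s),\qquad {_{b}\nabla^{-\beta}}f(t)=\frac{1}{\Gamma(\beta)}\sum_{s=t}^{b-1}(s-\rho(t))^{\overline{\beta-1}}f(s),$$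 with empty sums equal to $0$ (so $\nabla_a^{-\beta}f(a)=0$ and ${_{b}\nabla^{-\beta}}f(b)=0$); for $\beta=0$ both operators are the identity. For $n-1<\alpha\leq n$, the nabla left and right (Riemann--Liouville) fractional differences are $$\nabla_a^{\alpha}f(t)=\nabla^n\,\nabla_a^{-(n-\alpha)}f(t)\quad(t\in\mathbb{N}_{a+n}),\qquad {_{b}\nabla^{\alpha}}f(t)={_{\circleddash}\Delta^n}\,{_{b}\nabla^{-(n-\alpha)}}f(t)\quad(t\in{_{b-n}\mathbb{N}}).$$ For functions defined only on a finite set of points, these are considered at those $t$ for which all values occurring are defined. *)

(* Defs.v *)
From mathcomp Require Export all_boot all_order all_algebra.
From mathcomp Require Export all_classical all_reals all_analysis.

Set Implicit Arguments.
Unset Strict Implicit.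
Unset Printing Implicit Defensive.

Import Order.TTheory GRing.Theory Num.Theory.
Import numFieldNormedType.Exports.

Local Open Scope classical_set_scope.
Local Open Scope ring_scope.

Section NablaCalculus.
Context {R : realType}.
Implicit Types (a b t u x alpha beta : R) (f g : R -> R) (n : nat).

Definition Nfrom a : set R := [set t | exists k : nat, t = a + k%:R].

Definition Nto b : set R := [set t | exists k : nat, t = b - k%:R].

(* Functions on a discrete set are represented by total functions R -> R whose
   values outside the set are irrelevant.  Hence the symmetric dual is a
   relation constraining fs only on its domain, and f only on the domain of f. *)
Definition symmetric_dual a b f fs : Prop :=
  forall u, (Nfrom (- b) `&` Nto (- a)) u -> fs u = f (- u).

Definition Gamma_int x : R :=
  \int[@lebesgue_measure R]_(u in `]0, +oo[) (u `^ (x - 1) * expR (- u)).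

(* Euler's integral for x > 0 (then m = 0), extended to x <= 0 by the
   functional equation Gamma (x + 1) = x * Gamma x: m is the least natural
   number with 0 < x + m.  At the poles 0, -1, -2, ... the value is the
   irrelevant 0. *)
Definition Gamma x : R :=
  let m := Num.truncn (1 - x) in
  Gamma_int (x + m%:R) / \prod_(k < m) (x + k%:R).

(* Irrelevant value when t is a negative integer. *)
Definition rising t alpha : R :=
  if t == 0 then 0 else Gamma (t + alpha) / Gamma t.

Definition rho t : R := t - 1.

Definition Delta f : R -> R := fun t => f (t + 1) - f t.

Definition nabla f : R -> R := fun t => f t - f (t - 1).

Definition cdDelta n f : R -> R := fun t => (-1) ^+ n * iter n Delta f t.

(* The index sets below are finite, so these are genuine finite sums. *)
Definition nabla_sum_left a beta f : R -> R := fun t =>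
  if beta == 0 then f t else
  (Gamma beta)^-1 *
    \sum_(s \in Nfrom (a + 1) `&` Nto t) (rising (t - rho s) (beta - 1) * f s).

Definition nabla_sum_right b beta f : R -> R := fun t =>
  if beta == 0 then f t else
  (Gamma beta)^-1 *
    \sum_(s \in Nfrom t `&` Nto (b - 1)) (rising (s - rho t) (beta - 1) * f s).

(* The integer n with n - 1 < alpha <= n, for alpha > 0. *)
Definition frac_order alpha : nat := `|Num.ceil alpha|%N.

Definition nabla_left a alpha f : R -> R :=
  let n := frac_order alpha in
  iter n nabla (nabla_sum_left a (n%:R - alpha) f).

Definition nabla_right b alpha f : R -> R :=
  let n := frac_order alpha in
  cdDelta n (nabla_sum_right b (n%:R - alpha) f).

End NablaCalculus.

(* Main.v *)
Require Import Defs.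
From mathcomp Require Import ring.
Import Order.TTheory GRing.Theory Num.Theory.
Set Implicit Arguments.
Unset Strict Implicit.
Local Open Scope classical_set_scope.
Local Open Scope ring_scope.

(** The reflection [s -> - s] turns each ingredient of the left difference into its right
    counterpart. It maps the summation range of the left sum onto that of the right sum and
    preserves the kernel argument ([nabla_sum_opp]). It also turns a backward difference into minus
    a forward one, and the sign $(-1)^n$ in [cdDelta] absorbs these minus signs
    ([iter_nabla_opp]). *)

(** Agreement is asked only at the [n + 1] points that the iterated difference reads, because the
    two fractional sums are known to match only on the domain of [f]. *)
Lemma iter_nabla_opp (R : realType) (g h : R -> R) (n : nat) (t : R) :
  (forall j : nat, (j <= n)%N -> g (t - j%:R) = h (- (t - j%:R))) ->
  iter n nabla g t = cdDelta n h (- t).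
Proof.
elim: n t => [|n IHn] t gh.
  by rewrite /cdDelta /= mul1r; have := gh 0 isT; rewrite subr0.
rewrite iterS {1}/nabla !IHn => [|j jn|j jn].
- rewrite /cdDelta iterS {3}/Delta exprS opprB [1 - t]addrC; ring.
- by have -> : t - 1 - j%:R = t - j.+1%:R; [rewrite -[j.+1]addn1 natrD; ring | exact: gh].
- exact/gh/leqW.
Qed.

Lemma NfromN (R : realType) (a u : R) : Nfrom (- a) u <-> Nto a (- u).
Proof.
split=> -[k e]; exists k; first by rewrite e opprD opprK.
by rewrite -[u]opprK e opprB addrC.
Qed.

Lemma NtoN (R : realType) (a u : R) : Nto (- a) u <-> Nfrom a (- u).
Proof. by rewrite -{2}[a]opprK NfromN opprK. Qed.

Lemma Nfrom_trans (R : realType) (a b c : R) : Nfrom a b -> Nfrom b c -> Nfrom a c.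
Proof. by move=> [k ->] [l ->]; exists (k + l)%N; rewrite natrD addrA. Qed.

Lemma Nto_Nfrom (R : realType) (a b : R) : Nto b a <-> Nfrom a b.
Proof. by split=> -[k ->]; exists k; rewrite (subrK, addrK). Qed.

Lemma Nfrom_addn (R : realType) (a : R) (k : nat) : Nfrom a (a + k%:R).
Proof. by exists k. Qed.

(** The point [t = a] is included since the differences reach down to it: both sums are empty there
    if [beta] is nonzero, and duality at [a] itself settles [beta = 0]. *)
Lemma nabla_sum_opp (R : realType) (a b : R) (f fs : R -> R) (beta t : R) :
  symmetric_dual a b f fs -> Nfrom a t -> Nto b t ->
  nabla_sum_left a beta f t = nabla_sum_right (- a) beta fs (- t).
Proof.
move=> hfs at_ tb.
have fE s : Nfrom a s -> Nto b s -> f s = fs (- s).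
  move=> as_ sb; rewrite hfs ?opprK//.
  by split; [apply/NfromN | apply/NtoN]; rewrite opprK.
rewrite /nabla_sum_left /nabla_sum_right; case: ifP => _; first exact: fE.
congr (_ * _).
(* Negation is a bijection from $\{a+1,\ldots,t\}$ onto $\{-t,\ldots,-a-1\}$. *)
rewrite [RHS](reindex_fsbig (@GRing.opp R) (Nfrom (a + 1) `&` Nto t)); last first.
  split=> [s [as_ st]|x y _ _ /oppr_inj//|u [tu ua]] /=.
    by split; [apply/NfromN | rewrite -opprD; apply/NtoN]; rewrite opprK.
  exists (- u); last exact: opprK.
  by split; [apply/NtoN; rewrite opprD | apply/NfromN].
apply: eq_fsbigr => s /set_mem[a1s st]; rewrite fE.
(* Both kernel arguments equal $t-s+1$. *)
- by congr (rising _ _ * _); rewrite /rho; ring.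
- exact: Nfrom_trans (Nfrom_addn a 1) a1s.
- by move/Nto_Nfrom: tb; move/Nto_Nfrom: st => /Nfrom_trans h /h/Nto_Nfrom.
Qed.

Lemma frac_orderE (R : realType) (n : nat) (alpha : R) :
  n%:R - 1 < alpha <= n%:R -> frac_order alpha = n.
Proof. by move=> h; rewrite /frac_order (@ceil_def _ _ n%:Z) // intrB. Qed.

Theorem theorem23 (R : realType) (a b : R) (f fs : R -> R)
    (hfs : symmetric_dual a b f fs) (n : nat) (hn : (1 <= n)%N)
    (alpha : R) (halpha : n%:R - 1 < alpha <= n%:R) (t : R)
    (ht : (Nfrom (a + n%:R) `&` Nto b) t) :
  nabla_left a alpha f t = nabla_right (- a) alpha fs (- t).
Proof.
case: ht => -[k ->] tb; rewrite /nabla_left /nabla_right (frac_orderE halpha).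
apply: iter_nabla_opp => j jn; apply: (nabla_sum_opp _ hfs).
  (* Starting at [a + n] keeps all points [t - j] with [j <= n] at or above [a]. *)
  by exists (n - j + k)%N; rewrite natrD natrB//; ring.
move/Nto_Nfrom: tb => tb; apply/Nto_Nfrom; apply: (Nfrom_trans _ tb).
by exists j; rewrite subrK.
Qed.
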